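(* Let $G=(V,E,\mathbf{w}_0)$ be a connected finite weighted graph with $E=\{e_1,\dots,e_m\}$ and initial weight $\mathbf{w}_0=(w_{0,e})_{e\in E}\in\mathbb{R}_+^m$. Then for any step size $s>0$, with $t_j=js$ for $j=0,1,2,\dots$, the discrete cohesion flow $$\begin{cases} w_e(t_{j+1})=w_e(t_j)+s\,C_e(t_j),\\ w_e(t_j)>0,\quad j=0,1,2,\dots,\\ w_e(0)=w_{0,e}, \end{cases}\qquad \forall e\in E,$$ where $C_e(t_j)$ is the cohesion of $e$ computed with respect to the weight vector $\mathbf{w}(t_j)=(w_e(t_j))_{e\in E}$, admits a unique solution $\mathbf{w}(t_j)=(w_e(t_j))_{e\in E}$ for all $j=0,1,2,\dots$. Moreover, for every edge $e\in E$, $w_e(t_j)$ is strictly increasing in $j$ and $\lim_{j\to+\infty}w_e(t_j)=+\infty$.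
   Context: $\mathbb{R}_+^m=\{\mathbf{a}=(a_1,\dots,a_m)\in\mathbb{R}^m: a_j>0 \text{ for all } 1\le j\le m\}$. A connected finite weighted graph $G=(V,E,\mathbf{w})$ is a finite connected simple undirected graph with vertex set $V=\{x_1,\dots,x_n\}$, edge set $E=\{e_1,\dots,e_m\}$, and edge weights $\mathbf{w}=(w_e)_{e\in E}$, $w_e>0$ for all $e$. Write $x\sim y$ if $x,y$ are adjacent, $xy$ for the edge joining them, and $w_{xy}=w_{yx}$ for its weight. For $x\in V$ let $\mathscr{N}_x=\{u\in V: u\sim x\text{ or }u=x\}$, and for an edge $xy$ let $\mathscr{N}_{xy}=\{z\in V: z\sim x\text{ and }z\sim y\}$. Cohesion. For an edge $e=xy\in E$ and weight vector $\mathbf{w}$, set $$A_{xy}=\sum_{u\in\mathscr{N}_x\setminus\mathscr{N}_y}\frac1{w_{xu}}+\sum_{u\in\mathscr{N}_y\setminus\mathscr{N}_x}\frac1{w_{yu}},\qquad B_{xy}=\sum_{z\in\mathscr{N}_{xy}}\left(\frac1{w_{xz}}+\frac1{w_{yz}}\right),$$ $$\widetilde{C}_{xy}=\begin{cases}\dfrac{A_{xy}-B_{xy}}{A_{xy}+B_{xy}}, & A_{xy}+B_{xy}>0,\\ 0, & A_{xy}+B_{xy}=0.\end{cases}$$ The cohesion of $e=xy$ is $C_e=C_{xy}=\exp(\widetilde{C}_{xy})$. *)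

(* Defs.v *)
From HB Require Import structures.
From mathcomp Require Import all_boot all_order all_algebra.
From mathcomp Require Import all_classical all_reals all_analysis.

Set Implicit Arguments.
Unset Strict Implicit.
Unset Printing Implicit Defensive.

Import Order.TTheory GRing.Theory Num.Theory.
Import numFieldNormedType.Exports.

Local Open Scope ring_scope.

Record connected_simple_graph (V : finType) (adj : rel V) : Prop := {
  adj_sym : symmetric adj;
  adj_irr : irreflexive adj;
  vertex_gt0 : (0 < #|V|)%N;
  adj_connected : forall x y : V, connect adj x y
}.

Section Cohesion.
Variables (R : realType) (V : finType) (adj : rel V).

Definition edge_set : {set {set V}} :=
  [set [set p.1; p.2] | p : V * V & adj p.1 p.2].

Definition edge := {d : {set V} | d \in edge_set}.

Implicit Types (w : {ffun edge -> R}) (x y : V).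

(* The weight w_xy of the edge xy. The value 0 at non-adjacent pairs is a
   placeholder: when x and y are adjacent, the sums below only involve pairs
   that are edges. *)
Definition weight w x y : R := oapp w 0 (insub [set x; y]).

Definition closed_nbhd x : {set V} := [set u | adj u x || (u == x)].

Definition common_nbhd x y : {set V} := [set z | adj z x && adj z y].

Definition cohesionA w x y : R :=
  \sum_(u in closed_nbhd x :\: closed_nbhd y) (weight w x u)^-1 +
  \sum_(u in closed_nbhd y :\: closed_nbhd x) (weight w y u)^-1.

Definition cohesionB w x y : R :=
  \sum_(z in common_nbhd x y) ((weight w x z)^-1 + (weight w y z)^-1).

(* For positive weights A + B >= 0, so the else branch is the case A + B = 0. *)
Definition log_cohesion w x y : R :=
  let A := cohesionA w x y in
  let B := cohesionB w x y in
  if 0 < A + B then (A - B) / (A + B) else 0.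

Definition cohesion w x y : R := expR (log_cohesion w x y).

(* [w j] is the weight vector at time t_j = j * s. In [flow_step], both
   orderings (x, y) of the endpoints of an edge are allowed; [cohesion] is
   symmetric in x and y, so they give the same equation. *)
Record cohesion_flow (s : R) (w0 : {ffun edge -> R})
    (w : nat -> {ffun edge -> R}) : Prop := {
  flow_step : forall (j : nat) (d : edge) (x y : V), val d = [set x; y] ->
    w j.+1 d = w j d + s * cohesion (w j) x y;
  flow_gt0 : forall (j : nat) (d : edge), 0 < w j d;
  flow_init : forall d : edge, w 0%N d = w0 d
}.

End Cohesion.

(* Main.v *)
Require Import Defs.
From HB Require Import structures.
From mathcomp Require Import all_boot all_order all_algebra.
From mathcomp Require Import all_classical all_reals all_analysis.

Import Order.TTheory GRing.Theory Num.Theory.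
Import numFieldNormedType.Exports.

Local Open Scope classical_set_scope.
Local Open Scope ring_scope.

(** The step is explicit, so a solution is the orbit of [w0] under the map
    [w |-> w + s * C(w)], and existence and uniqueness only ask that this map
    be well defined and preserve positivity. It is well defined because the
    cohesion of an edge does not depend on the order of its endpoints
    ([cohesion_pair]), and it preserves positivity because the added term is a
    positive multiple of an exponential.

    The growth comes from a bound uniform in [w]: for positive weights [A] and
    [B] are nonnegative, so [(A - B) / (A + B) >= -1] and every cohesion is at
    least [exp (-1)] ([cohesion_ge]). Each weight therefore increases by at
    least [s * exp (-1)] at each step, which gives strict monotonicity and at
    least linear growth ([cohesion_flow_ge]). *)

Lemma set2_eq (T : finType) (a b c e : T) :
  [set a; b]%SET = [set c; e]%SET -> (a = c /\ b = e) \/ (a = e /\ b = c).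
Proof.
move=> E.
have : a \in [set c; e]%SET by rewrite -E !inE eqxx.
have : b \in [set c; e]%SET by rewrite -E !inE eqxx orbT.
have : c \in [set a; b]%SET by rewrite E !inE eqxx.
have : e \in [set a; b]%SET by rewrite E !inE eqxx orbT.
by rewrite !inE; do 4![case/orP=> /eqP ?]; subst; auto.
Qed.

Section CohesionOfAnEdge.
Context {R : realType} {V : finType} {adj : rel V}.
Implicit Types (w : {ffun edge adj -> R}) (x y : V) (d : edge adj).

Lemma cohesionC w x y : cohesion w x y = cohesion w y x.
Proof.
have AC : cohesionA w x y = cohesionA w y x by rewrite /cohesionA addrC.
have BC : cohesionB w x y = cohesionB w y x.
  rewrite /cohesionB; apply: eq_big => [z|z _]; last by rewrite addrC.
  by rewrite !inE andbC.
by rewrite /cohesion /log_cohesion AC BC.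
Qed.

Lemma cohesion_pair w x y x' y' :
  [set x; y]%SET = [set x'; y']%SET -> cohesion w x y = cohesion w x' y'.
Proof. by case/set2_eq=> -[-> ->] //; rewrite cohesionC. Qed.

Lemma edge_endpoints d : exists p : V * V, val d == [set p.1; p.2]%SET.
Proof. by have /imsetP[p _ ->] := valP d; exists p. Qed.

(** An edge is an unordered pair, while the cohesion takes its endpoints in
    some order; by [cohesion_pair] the chosen order is immaterial. *)
Definition edge_cohesion w d : R :=
  let p := xchoose (edge_endpoints d) in cohesion w p.1 p.2.

Lemma edge_cohesionE w d x y :
  val d = [set x; y]%SET -> cohesion w x y = edge_cohesion w d.
Proof.
by move=> dxy; apply: cohesion_pair; rewrite -dxy;
  apply/eqP/(xchooseP (edge_endpoints d)).
Qed.

Lemma weight_ge0 w x y : (forall d, 0 < w d) -> 0 <= weight w x y.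
Proof.
by move=> w_gt0; rewrite /weight; case: insub => //= d; apply: ltW.
Qed.

Lemma cohesionA_ge0 w x y : (forall d, 0 < w d) -> 0 <= cohesionA w x y.
Proof.
by move=> w_gt0; apply: addr_ge0; apply: sumr_ge0 => u _;
  rewrite invr_ge0 weight_ge0.
Qed.

Lemma cohesionB_ge0 w x y : (forall d, 0 < w d) -> 0 <= cohesionB w x y.
Proof.
by move=> w_gt0; apply: sumr_ge0 => u _;
  rewrite addr_ge0 // invr_ge0 weight_ge0.
Qed.

(** [A - B >= -(A + B)] because [A >= 0]; the default value [0] of the
    logarithm also lies above [-1]. *)
Lemma cohesion_ge w x y :
  (forall d, 0 < w d) -> expR (-1) <= cohesion w x y.
Proof.
move=> w_gt0; rewrite ler_expR /log_cohesion.
case: ifPn => [AB_gt0|_]; last by rewrite lerN10.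
rewrite ler_pdivlMr // mulN1r opprD lerD2r.
by rewrite ge0_cp // cohesionA_ge0.
Qed.

End CohesionOfAnEdge.

Section Flow.
Context {R : realType} {V : finType} {adj : rel V}.
Variables (s : R) (w0 : {ffun edge adj -> R}).
Hypothesis s_gt0 : 0 < s.
Implicit Types (w : nat -> {ffun edge adj -> R}) (d : edge adj).

Definition euler_step (u : {ffun edge adj -> R}) : {ffun edge adj -> R} :=
  [ffun d => u d + s * edge_cohesion u d].

Definition euler_orbit (j : nat) : {ffun edge adj -> R} :=
  iter j euler_step w0.

Lemma euler_orbit_flow :
  (forall d, 0 < w0 d) -> cohesion_flow s w0 euler_orbit.
Proof.
move=> w0_gt0; split=> //.
  by move=> j d x y dxy; rewrite /= ffunE (edge_cohesionE _ _ _ _ dxy).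
elim=> [|j IHj] d //=.
by rewrite ffunE addr_gt0 ?IHj // mulr_gt0 // expR_gt0.
Qed.

Lemma cohesion_flow_step w j :
  cohesion_flow s w0 w -> w j.+1 = euler_step (w j).
Proof.
case=> step _ _; apply/ffunP => d.
have [p /eqP dp] := edge_endpoints d.
by rewrite ffunE (step j d _ _ dp) (edge_cohesionE _ _ _ _ dp).
Qed.

Lemma cohesion_flow_orbit w : cohesion_flow s w0 w -> w = euler_orbit.
Proof.
move=> flow; apply/funext; elim=> [|j IHj].
  by apply/ffunP => d; apply: flow_init flow d.
by rewrite (cohesion_flow_step _ _ flow) IHj.
Qed.

Lemma cohesion_flow_incr w j d :
  cohesion_flow s w0 w -> w j d + s * expR (-1) <= w j.+1 d.
Proof.
move=> flow; rewrite (cohesion_flow_step _ _ flow) ffunE.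
by rewrite lerD2l ler_pM2l // cohesion_ge // => e; apply: flow_gt0 flow _ _.
Qed.

Lemma cohesion_flow_lt w d i j :
  cohesion_flow s w0 w -> (i < j)%N -> w i d < w j d.
Proof.
move=> flow; apply: (homo_ltn (f := w ^~ d) lt_trans) => k.
by apply: lt_le_trans _ (cohesion_flow_incr _ _ _ flow);
  rewrite ltrDl mulr_gt0 // expR_gt0.
Qed.

Lemma cohesion_flow_ge w d j :
  cohesion_flow s w0 w -> j%:R * (s * expR (-1)) <= w j d.
Proof.
move=> flow; elim: j => [|j IHj].
  by rewrite mul0r; apply: ltW (flow_gt0 flow _ _).
apply: le_trans _ (cohesion_flow_incr _ _ _ flow).
by rewrite -natr1 mulrDl mul1r lerD2r.
Qed.

Lemma cohesion_flow_cvgy w d :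
  cohesion_flow s w0 w -> w j d @[j --> \oo] --> +oo.
Proof.
move=> flow; apply/cvgryPge => A.
have c_gt0 : 0 < s * expR (-1) :> R by rewrite mulr_gt0 // expR_gt0.
near=> j; apply: le_trans _ (cohesion_flow_ge _ _ _ flow).
rewrite -ler_pdivrMr //; near: j; exact: nbhs_infty_ger.
Unshelve. all: by end_near. Qed.

End Flow.

Theorem theorem2p4 (R : realType) (V : finType) (adj : rel V)
    (hG : connected_simple_graph adj)
    (w0 : {ffun edge adj -> R}) (hw0 : forall d : edge adj, 0 < w0 d)
    (s : R) (hs : 0 < s) :
  (exists! w : nat -> {ffun edge adj -> R}, cohesion_flow s w0 w) /\
  (forall w : nat -> {ffun edge adj -> R}, cohesion_flow s w0 w ->
     forall d : edge adj,
       (forall i j : nat, (i < j)%N -> w i d < w j d) /\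
       (w j d @[j --> \oo] --> +oo)).
Proof.
split.
  exists (euler_orbit s w0); split; first exact: euler_orbit_flow.
  by move=> w flow; rewrite (cohesion_flow_orbit _ _ _ flow).
move=> w flow d; split.
  by move=> i j; apply: cohesion_flow_lt hs _ _ _ _ flow.
exact: cohesion_flow_cvgy hs _ _ flow.
Qed.
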